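(* Let $A(x,y)$, $B(b)$, $C(x,y)$ be families of operators on $\mathbb C^2\otimes\mathbb C^2$ depending on complex parameters $b,x,y$, such that on $(\mathbb C^2)^{\otimes 3}$ $$A_{12}(x,y)\,B_{13}(b)\,C_{23}(x,y)=C_{23}(x,y)\,B_{13}(b)\,A_{12}(x,y)$$ for all $b,x,y$, and such that $A(x,y)$ is invertible for all $x,y$. For $L\ge1$ define on $(\mathbb C^2)^{\otimes L}$ the transfer matrices $$\tau_B(b)=\operatorname{tr}_a\big(B_{aL}(b)\cdots B_{a1}(b)\big),\qquad \tau_C(x,y)=\operatorname{tr}_a\big(C_{aL}(x,y)\cdots C_{a1}(x,y)\big).$$ Then $$[\tau_B(b),\tau_C(x,y)]=0\quad\text{for all } b,x,y.$$ Consequently, if $\tau_C$ has a convergent power series expansion around some point $(x_0,y_0)$, then every coefficient of this expansion commutes with $\tau_B(b)$ for every $b$; and if moreover $B(0)=P$ and $\tau_B(b)=\sum_{m\ge0}b^mI_{B;m}$ is a convergent expansion around the regular point $b=0$, then every such coefficient of $\tau_C$ commutes with every $I_{B;m}$.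
   Context: For an operator $O$ on $\mathbb C^2\otimes\mathbb C^2$, $O_{jk}$ denotes $O$ acting on the $j$-th and $k$-th tensor factors (in that order) and as the identity on the others. In the transfer matrices, $a$ labels an additional auxiliary copy of $\mathbb C^2$, $1,\dots,L$ label the physical copies of $\mathbb C^2$, and $\operatorname{tr}_a$ is the partial trace over the auxiliary copy, so that $\tau_B,\tau_C$ act on $(\mathbb C^2)^{\otimes L}$. $P$ is the permutation operator $P(u\otimes v)=v\otimes u$; ''$b=0$ is a regular point of $B$'' means $B(0)=P$. *)

(* Defs.v *)
From HB Require Import structures.
From mathcomp Require Import all_boot all_order all_algebra.
From mathcomp Require Import all_classical all_reals all_analysis.
From mathcomp Require Import complex summability.

Set Implicit Arguments.
Unset Strict Implicit.
Unset Printing Implicit Defensive.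

Import Order.TTheory GRing.Theory Num.Theory.
Import numFieldNormedType.Exports.

Local Open Scope ring_scope.

(* Packaging R[i] as a numClosedFieldType gives it, and the matrices over it,
   the topology of the modulus: the numFieldNormedType instances are attached
   to the structure projections and do not fire on the bare carrier R[i]. *)
Definition CC (R : realType) : numClosedFieldType := R[i].

(* (K^2)^{(x)n} in coordinates: the standard basis vector
   e_(s 0) (x) ... (x) e_(s (n-1)) is indexed by s : conf n.
   Operators are square matrices acting on column vectors, so the entry
   (s', s) is the coefficient of e_s' in the image of e_s and operator
   composition is *m. *)
Notation conf n := {ffun 'I_n -> 'I_2}.
Notation op K n := 'M[K]_#|{: conf n}|.

Section Operators.
Variable K : fieldType.

Definition mk_op n (f : conf n -> conf n -> K) : op K n :=
  \matrix_(i, j) f (enum_val i) (enum_val j).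

Definition op_entry n (M : op K n) (s' s : conf n) : K :=
  M (enum_rank s') (enum_rank s).

Definition conf_pair n (j k : 'I_n) (s : conf n) : conf 2 :=
  [ffun i : 'I_2 => s (if i == ord0 then j else k)].

(* O_{jk}; only meaningful for j != k. *)
Definition op_at n (j k : 'I_n) (O : op K 2) : op K n :=
  mk_op (fun s' s : conf n =>
    if [forall l, (l != j) && (l != k) ==> (s' l == s l)]
    then op_entry O (conf_pair j k s') (conf_pair j k s) else 0).

Definition conf_cons n (u : 'I_2) (s : conf n) : conf n.+1 :=
  [ffun i => if unlift ord0 i is Some j then s j else u].

(* Partial trace over the tensor factor of index 0. *)
Definition ptrace n (M : op K n.+1) : op K n :=
  mk_op (fun s' s : conf n =>
    \sum_(u < 2) op_entry M (conf_cons u s') (conf_cons u s)).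

(* tr_a (X_{aL} ... X_{a1}) on a (x) 1 (x) ... (x) L: the auxiliary factor a
   has index 0 and the physical factor j has index j, for 1 <= j <= L. *)
Definition transfer L (X : op K 2) : op K L :=
  ptrace (\big[mulmx/1%:M]_(j < L) op_at ord0 (lift ord0 (rev_ord j)) X).

Definition tens2 (u v : 'cV[K]_2) : 'cV[K]_#|{: conf 2}| :=
  \col_i (let s : conf 2 := enum_val i in u (s ord0) 0 * v (s ord_max) 0).

Definition perm_op : op K 2 :=
  mk_op (fun s' s : conf 2 =>
    ((s' ord0 == s ord_max) && (s' ord_max == s ord0))%:R).

Lemma perm_op_tens2 (u v : 'cV[K]_2) : perm_op *m tens2 u v = tens2 v u.
Proof.
apply/colP => i; rewrite !mxE /=.
set t : conf 2 := enum_val i.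
pose s : conf 2 := [ffun l => t (if l == ord0 then ord_max else ord0)].
rewrite (bigD1 (enum_rank s)) //= big1 => [|j js].
  by rewrite !mxE enum_rankK /= -/t !ffunE !eqxx /= mul1r addr0 mulrC.
rewrite !mxE /= -/t; case: eqP => [e0|]; last by rewrite mul0r.
case: eqP => [e1|]; last by rewrite mul0r.
case/eqP: js; apply: enum_val_inj; rewrite enum_rankK.
apply/ffunP => l; rewrite ffunE.
case: eqP => [->|]; first by rewrite e1.
case: (unliftP ord0 l) => [m|] -> // _.
by rewrite (ord1 m) e0; congr (fun_of_fin _ _); apply: val_inj.
Qed.

End Operators.

Arguments perm_op {K}.

(* The expansion sum_(j, k) (x - x0)^j (y - y0)^k T_(j, k) converges to F x y
   for all (x, y) near (x0, y0); the double series is summed unconditionally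
   (along the net of finite subsets of nat * nat), which for a power series
   on a neighbourhood is the usual absolute convergence. *)
Definition expansion2 (K : numClosedFieldType) n (F : K -> K -> 'M[K]_n)
    (x0 y0 : K) (T : nat * nat -> 'M[K]_n) : Prop :=
  \forall p \near (x0, y0),
    (partial_sum
       (fun m => ((p.1 - x0) ^+ m.1 * (p.2 - y0) ^+ m.2) *: T m) @ totally
     --> F p.1 p.2)%classic.

Definition expansion (K : numClosedFieldType) n (F : K -> 'M[K]_n)
    (b0 : K) (T : nat -> 'M[K]_n) : Prop :=
  \forall b \near b0,
    (series (fun m => (b - b0) ^+ m *: T m) @ \oo --> F b)%classic.

(* Main.v *)
(* Entrywise, a transfer matrix is a matrix product operator: its (s', s) entry
   is the trace of an ordered product over the sites j of 2 x 2 Lax matrices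
   depending only on (s'_j, s_j).  Hence the entries of tau_B tau_C and of
   tau_C tau_B are traces of ordered products of 4 x 4 matrices V(s'_j, s_j)
   and V'(s'_j, s_j), and the Yang-Baxter relation says A V = V' A on each
   site, so the two products are conjugate by A.

   For the expansions, an entry of the commutator [T_m, tau_B] is a coefficient
   of a double power series summing to 0 near the base point.  Along the curve
   x = t^(k0+1), y = t, where (j0, k0) is the lexicographically least index of a
   nonzero coefficient, this index alone has the least order in t, and a
   geometric bound on the other terms forces its coefficient to vanish. *)

Require Import Defs.
From mathcomp Require Import all_boot all_order all_algebra.
From mathcomp Require Import all_classical all_reals all_analysis.
From mathcomp Require Import finmap ring zify.
From mathcomp.analysis Require Import summability.

Set Implicit Arguments.
Unset Strict Implicit.
Unset Printing Implicit Defensive.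

Import Order.TTheory GRing.Theory Num.Theory.
Import numFieldNormedType.Exports.

Local Open Scope ring_scope.

(** * Operators in coordinates *)

Section TransferAlgebra.
Variable K : fieldType.
Implicit Types (X Y : op K 2).

Lemma op_entry_mk n (f : conf n -> conf n -> K) s' s :
  op_entry (mk_op f) s' s = f s' s.
Proof. by rewrite /op_entry mxE !enum_rankK. Qed.

Lemma op_entryP n (M N : op K n) :
  (forall s' s, op_entry M s' s = op_entry N s' s) -> M = N.
Proof.
move=> MN; apply/matrixP => i j.
by have := MN (enum_val i) (enum_val j); rewrite /op_entry !enum_valK.
Qed.

Lemma op_entryM n (M N : op K n) s' s :
  op_entry (M *m N) s' s = \sum_t op_entry M s' t * op_entry N t s.
Proof.
rewrite /op_entry mxE (reindex enum_rank) //.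
by apply: onW_bij; exact: enum_rank_bij.
Qed.

Lemma op_entry1 n (s' s : conf n) : op_entry (1%:M : op K n) s' s = (s' == s)%:R.
Proof. by rewrite /op_entry mxE (inj_eq enum_rank_inj). Qed.

Lemma op_entry_sum n I (r : seq I) (F : I -> op K n) s' s :
  op_entry (\sum_(i <- r) F i) s' s = \sum_(i <- r) op_entry (F i) s' s.
Proof. by rewrite /op_entry summxE. Qed.

Lemma op_tr n (M : op K n) : \tr M = \sum_s op_entry M s s.
Proof.
rewrite /mxtrace (reindex enum_rank) //.
by apply: onW_bij; exact: enum_rank_bij.
Qed.

Definition pair2 (u v : 'I_2) : conf 2 := [ffun i => if i == ord0 then u else v].

Definition triple (u v w : 'I_2) : conf 3 :=
  [ffun i => if i == 0 :> 'I_3 then u else if i == 1 then v else w].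

Lemma pair2K (s : conf 2) : pair2 (s ord0) (s ord_max) = s.
Proof.
apply/ffunP => i; rewrite ffunE; case: eqP => [->//|].
case: (unliftP ord0 i) => [j|] -> // _.
by congr (s _); apply: val_inj; rewrite (ord1 j).
Qed.

Lemma sum_pair2 (V : nmodType) (F : conf 2 -> V) :
  \sum_s F s = \sum_u \sum_v F (pair2 u v).
Proof.
rewrite pair_bigA /= (reindex (fun p : 'I_2 * 'I_2 => pair2 p.1 p.2)) //=.
exists (fun s : conf 2 => (s ord0, s ord_max)) => [[u v] _|s _] /=.
  by rewrite !ffunE.
exact: pair2K.
Qed.

Lemma sum_triple (V : nmodType) (F : conf 3 -> V) :
  \sum_s F s = \sum_u \sum_v \sum_w F (triple u v w).
Proof.
pose f (p : 'I_2 * 'I_2 * 'I_2) := triple p.1.1 p.1.2 p.2.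
rewrite pair_bigA /= pair_bigA /= (reindex f) //=.
exists (fun s : conf 3 => (s 0, s 1, s 2)) => [[[u v] w] _|s _] /=.
  by rewrite !ffunE.
apply/ffunP => i; rewrite !ffunE /=.
case: eqP => [->//|i0]; case: eqP => [->//|i1].
congr (s _); apply: val_inj; case: i i0 i1 => [[|[|[|]]]] //= p i0 i1.
  by case: i0; apply: val_inj.
by case: i1; apply: val_inj.
Qed.

Lemma sum_conf_cons (V : nmodType) n (F : conf n.+1 -> V) :
  \sum_s F s = \sum_u \sum_s F (conf_cons u s).
Proof.
rewrite pair_bigA /= (reindex (fun p : 'I_2 * conf n => conf_cons p.1 p.2)) //=.
exists (fun s : conf n.+1 => (s ord0, [ffun i => s (lift ord0 i)]))
  => [[u v] _|s _] /=.
  congr (_, _); first by rewrite ffunE unlift_none.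
  by apply/ffunP => i; rewrite !ffunE liftK.
by apply/ffunP => i; rewrite !ffunE; case: unliftP => [j|] -> //; rewrite ffunE.
Qed.

(** * Lax matrices and the entries of a transfer matrix *)

(* X as a 2 x 2 array, indexed by the physical factor, of operators on the
   auxiliary factor. *)
Definition lax X (a b : 'I_2) : 'M[K]_2 :=
  \matrix_(u', u) op_entry X (pair2 u' a) (pair2 u b).

Lemma op_at_cons n (j : 'I_n) X u' u s' s :
  op_entry (op_at ord0 (lift ord0 j) X) (conf_cons u' s') (conf_cons u s) =
  if [forall l, (l != j) ==> (s' l == s l)] then lax X (s' j) (s j) u' u else 0.
Proof.
rewrite op_entry_mk mxE.
have -> : [forall l, (l != ord0) && (l != lift ord0 j) ==>
             (conf_cons u' s' l == conf_cons u s l)] =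
          [forall l, (l != j) ==> (s' l == s l)].
  apply/forallP/forallP => H l; last first.
    case: (unliftP ord0 l) => [k|] ->; last by rewrite eqxx.
    by rewrite !ffunE liftK /= (inj_eq lift_inj).
  by have := H (lift ord0 l); rewrite !ffunE liftK /= (inj_eq lift_inj).
by case: ifP => // _; congr op_entry; apply/ffunP => i; rewrite !ffunE;
  case: ifP => _; rewrite ?unlift_none ?liftK.
Qed.

(** Each site occurs at most once in [r], so in the product of the head factor with the tail the
    intermediate physical configuration is forced: it is [s] at the head site and [s'] elsewhere
    ([t0] below). Only the auxiliary index is still summed, which leaves a product of Lax
    matrices. *)
Lemma monodromy_entry n (r : seq 'I_n) X u' u s' s : uniq r ->
  op_entry (\big[mulmx/1%:M]_(j <- r) op_at ord0 (lift ord0 j) X)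
    (conf_cons u' s') (conf_cons u s) =
  if [forall l, (l \notin r) ==> (s' l == s l)]
  then (\big[mulmx/1%:M]_(j <- r) lax X (s' j) (s j)) u' u else 0.
Proof.
elim: r u' s' => [|j r IHr] u' s' /=.
  move=> _; rewrite !big_nil op_entry1 mxE.
  case: forallP => [H|H].
    have -> : s' = s by apply/ffunP => l; exact/eqP/H.
    congr ((nat_of_bool _)%:R); apply/eqP/eqP => [/ffunP/(_ ord0)|->//].
    by rewrite !ffunE unlift_none.
  rewrite (_ : _ == _ = false) //; apply/eqP => /ffunP E; case: H => l.
  by have := E (lift ord0 l); rewrite !ffunE liftK => ->; exact: eqxx.
case/andP=> jr ur; rewrite !big_cons op_entryM sum_conf_cons.
pose t0 : conf n := [ffun l => if l == j then s l else s' l].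
have Et0 l : l != j -> t0 l = s' l by rewrite ffunE => /negPf ->.
have Et0j : t0 j = s j by rewrite ffunE eqxx.
rewrite mxE; case: forallP => H.
  apply: eq_bigr => v _; rewrite (bigD1 t0) //= big1 ?addr0 => [|t tt0];
    rewrite op_at_cons IHr //.
    case: forallP => [_|[]]; last by move=> l; apply/implyP => /Et0 ->.
    rewrite Et0j; case: forallP => [_|[]].
      congr (_ * _); congr (fun_of_matrix _ v u).
      apply: eq_big_seq => l lr; rewrite Et0 //.
      by apply: contraNneq jr => <-.
    move=> l; apply/implyP => lr; case: (eqVneq l j) => [->|lj].
      by rewrite Et0j.
    by rewrite Et0 //; apply: (implyP (H l)); rewrite inE negb_or lj.
  case: forallP => [H1|]; last by rewrite mul0r.
  case: forallP => [H2|]; last by rewrite mulr0.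
  case/eqP: tt0; apply/ffunP => l; rewrite ffunE; case: eqP => [->|/eqP lj].
    by apply/eqP; apply: (implyP (H2 j)).
  by apply/esym/eqP; apply: (implyP (H1 l)).
apply: big1 => v _; apply: big1 => t _; rewrite op_at_cons IHr //.
case: forallP => [H1|]; last by rewrite mul0r.
case: forallP => [H2|]; last by rewrite mulr0.
case: H => l; apply/implyP; rewrite inE negb_or => /andP[lj lr].
by rewrite (eqP (implyP (H1 l) lj)); exact: (implyP (H2 l)).
Qed.

Lemma transfer_entry L X s' s :
  op_entry (transfer L X) s' s =
  \tr (\prod_(j < L) lax X (s' (rev_ord j)) (s (rev_ord j))).
Proof.
rewrite op_entry_mk /mxtrace; apply: eq_bigr => u _.
(* The product is rewritten over the list of all [rev_ord j]; this list contains every site, so the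
   condition in [monodromy_entry] holds vacuously. *)
rewrite -[X in op_entry X](big_map (@rev_ord L) xpredT
  (fun j => op_at ord0 (lift ord0 j) X)).
rewrite monodromy_entry; last first.
  by rewrite (map_inj_uniq rev_ord_inj) index_enum_uniq.
rewrite big_map; case: forallP => // -[] l.
by rewrite -[l]rev_ordK map_f // mem_index_enum.
Qed.

(** * Products of two transfer matrices as one trace over two auxiliary factors *)

(** The tensor product of operators on the two auxiliary factors, indexed by [conf 2] so that it can
    be multiplied by [A]. *)
Definition kron (M N : 'M[K]_2) : op K 2 :=
  mk_op (fun s' s => M (s' ord0) (s ord0) * N (s' ord_max) (s ord_max)).

Lemma kron_entry M N u' v' u v :
  op_entry (kron M N) (pair2 u' v') (pair2 u v) = M u' u * N v' v.
Proof. by rewrite op_entry_mk !ffunE. Qed.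

Lemma kron1 : kron 1 1 = 1.
Proof.
apply: op_entryP => s' s; rewrite op_entry1 op_entry_mk !mxE -natrM mulnb.
congr (_%:R : K); congr nat_of_bool.
apply/andP/eqP => [[/eqP e0 /eqP e1]|->//].
by rewrite -[s']pair2K e0 e1 pair2K.
Qed.

Lemma kronM (M N M' N' : 'M[K]_2) : kron (M * M') (N * N') = kron M N * kron M' N'.
Proof.
apply: op_entryP => s' s; rewrite -[s']pair2K -[s]pair2K op_entryM sum_pair2.
rewrite kron_entry !mxE mulr_suml; apply: eq_bigr => u _.
rewrite mulr_sumr; apply: eq_bigr => v _.
by rewrite !kron_entry mulrACA.
Qed.

Lemma kron_tr M N : \tr (kron M N) = \tr M * \tr N.
Proof.
rewrite op_tr sum_pair2 mulr_suml; apply: eq_bigr => u _.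
by rewrite mulr_sumr; apply: eq_bigr => v _; rewrite kron_entry.
Qed.

Lemma kron_prod I (r : seq I) (F G : I -> 'M[K]_2) :
  kron (\prod_(i <- r) F i) (\prod_(i <- r) G i) = \prod_(i <- r) kron (F i) (G i).
Proof.
elim: r => [|i r IHr]; first by rewrite !big_nil kron1.
by rewrite !big_cons kronM IHr.
Qed.

Lemma sum_conf_rev (V : nmodType) n (F : conf n -> V) :
  \sum_s F s = \sum_(s : conf n) F [ffun j => s (rev_ord j)].
Proof.
rewrite (reindex (fun s : conf n => [ffun j => s (rev_ord j)])) //.
by exists (fun s : conf n => [ffun j => s (rev_ord j)]) => s _; apply/ffunP => j;
  rewrite !ffunE rev_ordK.
Qed.

(** A product of traces is the trace of a [kron], and distributing the product over sites across the
    sums over [b] yields the sum over all intermediate configurations. That configuration is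
    reversed because the sites are multiplied in reverse order. *)
Lemma transferM_entry L X Y s' s :
  op_entry (transfer L X *m transfer L Y) s' s =
  \tr (\prod_(j < L) \sum_b
     kron (lax X (s' (rev_ord j)) b) (lax Y b (s (rev_ord j)))).
Proof.
rewrite bigA_distr_bigA raddf_sum op_entryM sum_conf_rev; apply: eq_bigr => t _ /=.
rewrite !transfer_entry -kron_tr kron_prod.
by congr (\tr _); apply: eq_bigr => j _; rewrite !ffunE rev_ordK.
Qed.

(** Scalar entries commute, so the auxiliary factor of [X] can stay first in [kron] although
    [transfer L Y] now multiplies from the left. Both orders are thus traces over the same auxiliary
    pair. *)
Lemma transferM_entryC L X Y s' s :
  op_entry (transfer L Y *m transfer L X) s' s =
  \tr (\prod_(j < L) \sum_b
     kron (lax X b (s (rev_ord j))) (lax Y (s' (rev_ord j)) b)).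
Proof.
rewrite bigA_distr_bigA raddf_sum op_entryM sum_conf_rev; apply: eq_bigr => t _ /=.
rewrite mulrC !transfer_entry -kron_tr kron_prod.
by congr (\tr _); apply: eq_bigr => j _; rewrite !ffunE rev_ordK.
Qed.

(** * The Yang-Baxter relation on one site, and commutation of the transfer matrices *)

Lemma op_at_triple (X : op K 2) u' v' w' u v w :
  [/\ op_entry (op_at (0 : 'I_3) (1 : 'I_3) X) (triple u' v' w') (triple u v w)
      = op_entry X (pair2 u' v') (pair2 u v) * (w' == w)%:R,
      op_entry (op_at (0 : 'I_3) (2 : 'I_3) X) (triple u' v' w') (triple u v w)
      = op_entry X (pair2 u' w') (pair2 u w) * (v' == v)%:R
    & op_entry (op_at (1 : 'I_3) (2 : 'I_3) X) (triple u' v' w') (triple u v w)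
      = op_entry X (pair2 v' w') (pair2 v w) * (u' == u)%:R].
Proof.
have E (j k : 'I_3) :
    conf_pair j k (triple u v w) = pair2 (triple u v w j) (triple u v w k).
  by apply/ffunP => i; rewrite ffunE [RHS]ffunE; case: eqP.
have E' (j k : 'I_3) :
    conf_pair j k (triple u' v' w') =
    pair2 (triple u' v' w' j) (triple u' v' w' k).
  by apply/ffunP => i; rewrite ffunE [RHS]ffunE; case: eqP.
have all3 (P : pred 'I_3) : [forall l, P l] = [&& P 0, P 1 & P 2].
  apply/forallP/and3P => [H|[p0 p1 p2] l]; first by split; exact: H.
  have : [|| l == 0, l == 1 | l == 2].
    by case: l => -[|[|[|]]].
  by case/or3P => /eqP ->.
by split; rewrite op_entry_mk all3 E E' !ffunE /= ?andbT;
  case: eqP; rewrite ?mulr1 ?mulr0.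
Qed.

Lemma sum_delta (I : finType) (F : I -> K) a :
  \sum_x F x * (x == a)%:R = F a.
Proof.
rewrite (bigD1 a) //= eqxx mulr1 big1 ?addr0 // => x /negPf ->.
by rewrite mulr0.
Qed.

(** Factors 0 and 1 play the two auxiliary spaces and factor 2 a physical site; [b] is the
    intermediate state of that site. *)
Lemma lax_mul X Y u' v' w' u v w :
  op_entry (op_at (0 : 'I_3) (2 : 'I_3) X *m op_at (1 : 'I_3) (2 : 'I_3) Y)
    (triple u' v' w') (triple u v w) =
  op_entry (\sum_b kron (lax X w' b) (lax Y b w)) (pair2 u' v') (pair2 u v).
Proof.
rewrite op_entry_sum op_entryM sum_triple.
transitivity (\sum_x (\sum_z op_entry X (pair2 u' w') (pair2 x z)
                        * op_entry Y (pair2 v' z) (pair2 v w)) * (x == u)%:R).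
  apply: eq_bigr => x _; rewrite mulr_suml exchange_big /=; apply: eq_bigr => z _.
  (* [sum_delta] is used backwards: a trivial sum over [y] is inserted to match the triple sum of
     the matrix product term by term. *)
  rewrite -(sum_delta (fun y => _ * op_entry Y (pair2 y z) _) v') mulr_suml.
  apply: eq_bigr => y _; have [_ -> _] := op_at_triple X u' v' w' x y z.
  by have [_ _ ->] := op_at_triple Y x y z u v w; rewrite (eq_sym v'); ring.
by rewrite sum_delta; apply: eq_bigr => z _; rewrite kron_entry !mxE.
Qed.

Lemma lax_mulC X Y u' v' w' u v w :
  op_entry (op_at (1 : 'I_3) (2 : 'I_3) Y *m op_at (0 : 'I_3) (2 : 'I_3) X)
    (triple u' v' w') (triple u v w) =
  op_entry (\sum_b kron (lax X b w) (lax Y w' b)) (pair2 u' v') (pair2 u v).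
Proof.
rewrite op_entry_sum op_entryM sum_triple.
transitivity (\sum_x (\sum_z op_entry Y (pair2 v' w') (pair2 v z)
                        * op_entry X (pair2 x z) (pair2 u w)) * (x == u')%:R).
  apply: eq_bigr => x _; rewrite mulr_suml exchange_big /=; apply: eq_bigr => z _.
  rewrite -(sum_delta (fun y => op_entry Y _ (pair2 y z) * _) v) mulr_suml.
  apply: eq_bigr => y _; have [_ _ ->] := op_at_triple Y u' v' w' x y z.
  by have [_ -> _] := op_at_triple X x y z u v w; rewrite (eq_sym u'); ring.
rewrite sum_delta; apply: eq_bigr => z _; rewrite kron_entry !mxE.
by rewrite mulrC.
Qed.

(** The operator [A] acts as the identity on the physical factor, so fixing the physical indices [a]
    and [c] in the Yang-Baxter relation leaves a relation between operators on the auxiliary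
    pair. *)
Lemma lax_intertwine (A B C : op K 2) :
  op_at (0 : 'I_3) (1 : 'I_3) A *m op_at (0 : 'I_3) (2 : 'I_3) B
    *m op_at (1 : 'I_3) (2 : 'I_3) C
  = op_at (1 : 'I_3) (2 : 'I_3) C *m op_at (0 : 'I_3) (2 : 'I_3) B
    *m op_at (0 : 'I_3) (1 : 'I_3) A ->
  forall a c,
    A *m (\sum_b kron (lax B a b) (lax C b c)) =
    (\sum_b kron (lax B b c) (lax C a b)) *m A.
Proof.
move=> ybe a c; apply: op_entryP => s' s.
rewrite -[s']pair2K -[s]pair2K.
move: (s' _) (s' _) (s _) (s _) => v' u' v u.
have := congr1 (fun M => op_entry M (triple u' v' a) (triple u v c)) ybe.
rewrite -mulmxA !op_entryM !sum_triple !sum_pair2 => E.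
transitivity (\sum_x \sum_y \sum_z
    op_entry (op_at 0 1 A) (triple u' v' a) (triple x y z) *
    op_entry (op_at 0 2 B *m op_at 1 2 C) (triple x y z) (triple u v c)).
  apply: eq_bigr => x _; apply: eq_bigr => y _.
  rewrite -[LHS](sum_delta (fun z => _ * op_entry (\sum_b kron (lax B z b) _) _ _)).
  apply: eq_bigr => z _; rewrite lax_mul.
  by have [-> _ _] := op_at_triple A u' v' a x y z; rewrite (eq_sym a); ring.
rewrite {}E; apply: eq_bigr => x _; apply: eq_bigr => y _.
rewrite -[RHS](sum_delta (fun z => op_entry (\sum_b kron (lax B b z) _) _ _ * _)).
apply: eq_bigr => z _; rewrite lax_mulC.
by have [-> _ _] := op_at_triple A x y z u v c; ring.
Qed.

Lemma transfer_comm L (A B C : op K 2) :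
  A \in unitmx ->
  op_at (0 : 'I_3) (1 : 'I_3) A *m op_at (0 : 'I_3) (2 : 'I_3) B
    *m op_at (1 : 'I_3) (2 : 'I_3) C
  = op_at (1 : 'I_3) (2 : 'I_3) C *m op_at (0 : 'I_3) (2 : 'I_3) B
    *m op_at (0 : 'I_3) (1 : 'I_3) A ->
  comm_mx (transfer L B) (transfer L C).
Proof.
move=> Au /lax_intertwine ybe; apply: op_entryP => s' s.
rewrite transferM_entry transferM_entryC.
pose V j := \sum_b kron (lax B (s' (rev_ord j)) b) (lax C b (s (rev_ord j))).
pose V' j := \sum_b kron (lax B b (s (rev_ord j))) (lax C (s' (rev_ord j)) b).
rewrite -/(\prod_(j < L) V j) -/(\prod_(j < L) V' j).
(* The one-site relation carries [A] past one factor at a time; the empty product is the identity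
   [A *m invmx A]. Cyclicity of the trace then removes the conjugation. *)
have -> : \prod_j V' j = A *m \prod_j V j *m invmx A.
  elim: (index_enum _) => [|j r IHr].
    by rewrite !big_nil mulmx1 mulmxV.
  rewrite !big_cons IHr -[V j * _]/(V j *m _) -[V' j * _]/(V' j *m _).
  by rewrite !mulmxA -ybe.
by rewrite mxtrace_mulC !mulmxA mulVmx // mul1mx.
Qed.

End TransferAlgebra.

(** * Identity theorem for double power series, in terms of finite partial sums *)

Section PowerSeriesIdentity.
Variable K : numFieldType.

(** Every other nonzero term carries at least one more power of [s], so the other terms sum to at
    most [s ^+ (w i0).+1 * M]. Division by [s ^+ w i0] bounds [g i0] by a multiple of [s], which can
    be taken arbitrarily small. *)
Lemma leading_coef_eq0 (I : eqType) (g : I -> K) (w : I -> nat) i0 (M : K) :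
  (forall i, i != i0 -> g i != 0 -> (w i0 < w i)%N) ->
  (forall r, uniq r -> \sum_(i <- r) `|g i| <= M) ->
  (forall s e, 0 < s <= 1 -> 0 < e -> exists r,
     [/\ uniq r, i0 \in r & `|\sum_(i <- r) s ^+ w i * g i| <= e]) ->
  g i0 = 0.
Proof.
move=> wg gM small; apply/eqP/negPn/negP => g0.
have gi0 : 0 < `|g i0| by rewrite normr_gt0.
have gi0M : `|g i0| <= M by have := gM [:: i0] isT; rewrite big_seq1.
have M0 : 0 < M := lt_le_trans gi0 gi0M.
have bound s : 0 < s <= 1 -> `|g i0| <= s * (1 + M).
  (* The tolerance is [s ^+ (w i0).+1], of the same order as the bound on the other terms. *)
  move=> /[dup] s01 /andP[s0 s1]; have sd := exprn_gt0 (w i0).+1 s0.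
  have [r [ur i0r]] := small s _ s01 sd.
  rewrite (bigD1_seq i0) //= => le_sd.
  have : `|s ^+ w i0 * g i0| <= s ^+ (w i0).+1 + s ^+ (w i0).+1 * M.
    set rest := \sum_(i <- r | _) _ in le_sd.
    have -> : s ^+ w i0 * g i0 = (s ^+ w i0 * g i0 + rest) - rest by rewrite addrK.
    apply: le_trans (ler_normB _ _) _; apply: lerD => //.
    apply: le_trans (ler_norm_sum _ _ _) _.
    apply: (@le_trans _ _ (\sum_(i <- r) s ^+ (w i0).+1 * `|g i|)); last first.
      by rewrite -mulr_sumr ler_pM2l // gM.
    rewrite [leRHS](bigD1_seq i0) //=; apply: ler_wpDl.
      by rewrite mulr_ge0 // ltW.
    apply: ler_sum => i ii0; rewrite normrM normrX (gtr0_norm s0).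
    have [->|gi] := eqVneq (g i) 0; first by rewrite normr0 !mulr0.
    by apply: ler_wpM2r => //; apply: ler_wiXn2l; rewrite ?(ltW s0) ?wg.
  rewrite normrM normrX (gtr0_norm s0).
  rewrite (_ : _ + _ = s ^+ w i0 * (s * (1 + M))); last by rewrite exprSr; ring.
  by rewrite ler_pM2l ?exprn_gt0.
have M1 : 0 < 2 * (1 + M) by rewrite mulr_gt0 // addr_gt0.
(* This value of [s] turns the bound into [|g i0| <= |g i0| / 2]; it is at most 1 because
   [|g i0| <= M]. *)
have := bound (`|g i0| / (2 * (1 + M))).
rewrite divr_gt0 //= ler_pdivrMr // mul1r.
have -> : `|g i0| <= 2 * (1 + M).
  apply: le_trans gi0M _; rewrite -subr_ge0.
  by rewrite (_ : _ - _ = 2 + M) ?addr_ge0 ?(ltW M0) //; ring.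
have -> : `|g i0| / (2 * (1 + M)) * (1 + M) = `|g i0| / 2.
  by field; rewrite ?lt0r_neq0 ?addr_gt0.
move=> /(_ isT); rewrite ler_pdivlMr // -[leRHS]mulr1 ler_pM2l //.
by rewrite lt_geF // ltr1n.
Qed.


(** The finitely many indices lie in a square, over which the sum factors into two geometric sums,
    each at most 2. *)
Lemma sum_geo2_le (r : seq (nat * nat)) : uniq r ->
  \sum_(m <- r) (2^-1 ^+ m.1 * 2^-1 ^+ m.2 : K) <= 4.
Proof.
move=> ur; set h : K := 2^-1.
have h0 n : 0 <= h ^+ n by rewrite exprn_ge0 // invr_ge0.
have geo n : \sum_(i <- iota 0 n) h ^+ i = 2 - 2 * h ^+ n.
  elim: n => [|n IHn]; first by rewrite big_nil expr0; ring.
  by rewrite -addn1 iotaD big_cat big_seq1 IHn add0n addn1 exprSr mulrCA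
             mulfV // mulr1 /=; ring.
have geo2 n : \sum_(i <- iota 0 n) h ^+ i <= 2.
  by rewrite geo gerBl mulr_ge0.
have [N Nr] : {N | forall m, m \in r -> (maxn m.1 m.2 < N)%N}.
  exists (\max_(m <- r) maxn m.1 m.2).+1 => m mr.
  by rewrite ltnS (leq_bigmax_seq (F := fun m => maxn m.1 m.2) m).
apply: (@le_trans _ _ (\sum_(m <- [seq (i, j) | i <- iota 0 N, j <- iota 0 N])
                          h ^+ m.1 * h ^+ m.2)).
  rewrite [leRHS](bigID (mem r)) -[X in _ <= X + _]big_filter.
  rewrite [X in _ <= X + _](perm_big r) /=; last first.
    apply: uniq_perm => //.
      by rewrite filter_uniq // allpairs_uniq ?iota_uniq // => -[? ?] [? ?].
    move=> m; rewrite mem_filter; case: (boolP (m \in r)) => //= mr.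
    move: (Nr m mr); rewrite gtn_max => /andP[m1 m2].
    by apply/allpairsP; exists m; rewrite !mem_iota; case: m m1 m2 {mr}.
  by rewrite lerDl sumr_ge0 // => m _; rewrite mulr_ge0.
rewrite big_allpairs /=; under eq_bigr do rewrite -mulr_sumr.
rewrite -mulr_suml (_ : 4 = 2 * 2 :> K); last by rewrite -natrM.
by apply: ler_pM => //; apply: sumr_ge0.
Qed.

(** Convergence to 0 enters only through finite index sets that contain a prescribed index and have
    a small sum. Nets of finite sets and ordinary series both supply such sets. *)
Lemma power_series2_eq0 (a : nat * nat -> K) (d M : K) : 0 < d <= 1 ->
  (forall m, `|a m| * d ^+ (m.1 + m.2) <= M) ->
  (forall x y e m0, a m0 != 0 -> 0 <= x <= d -> 0 <= y <= d -> 0 < e -> exists r,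
     [/\ uniq r, m0 \in r & `|\sum_(m <- r) x ^+ m.1 * y ^+ m.2 * a m| <= e]) ->
  forall m, a m = 0.
Proof.
move=> /andP[d0 d1] aM small.
suff noa j : ~ exists k, a (j, k) != 0.
  by move=> [j k]; apply/eqP/negPn/negP => ajk; case: (noa j); exists k.
elim/ltn_ind: j => j0 IHj exk.
case: (ex_minnP exk) => k0 a0 mink.
(* The order in [t] of the monomial [m] along the curve; a row beyond [j0] gains at least [k0.+1],
   which exceeds [k0]. *)
pose w (m : nat * nat) := (m.1 * k0.+1 + m.2)%N.
(* With [t <= 1] and [t = d / 2], this inequality makes the bound at radius [d] a geometric one: [|t
   ^+ w m * a m| <= M * 2^-1 ^+ m.1 * 2^-1 ^+ m.2]. *)
have wge m : (m.1 + m.2 <= w m)%N by rewrite leq_add2r leq_pmulr.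
pose t := d / 2.
have t0 : 0 < t by rewrite divr_gt0.
have td : t <= d by rewrite ler_pdivrMr // ler_peMr // ?(ltW d0) // ler1n.
have t1 : t <= 1 := le_trans td d1.
have : t ^+ w (j0, k0) * a (j0, k0) = 0.
  (* The point [t] stays fixed and the curve is run through at parameter [s * t] with
     [0 < s <= 1]. *)
  apply: (leading_coef_eq0 (g := fun m => t ^+ w m * a m) (w := w) (M := M * 4)).
  - move=> [j k] jk; rewrite mulf_eq0 negb_or => /andP[_ ajk].
    have [jj0|jj0|jj0] := ltngtP j j0; rewrite /w /=.
    + by case: (IHj j jj0); exists k.
    + by nia.
    + subst j; have := mink _ ajk; rewrite leq_eqVlt => /orP[/eqP kk|]; last by lia.
      by rewrite kk eqxx in jk.
  - move=> r ur.
    apply: (@le_trans _ _ (\sum_(m <- r) M * (2^-1 ^+ m.1 * 2^-1 ^+ m.2))).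
      apply: ler_sum => m _; rewrite normrM normrX (gtr0_norm t0).
      apply: (@le_trans _ _ (t ^+ (m.1 + m.2) * `|a m|)).
        by apply: ler_wpM2r => //; apply: ler_wiXn2l; rewrite ?(ltW t0).
      rewrite -exprD exprMn mulrAC ler_wpM2r ?exprn_ge0 ?invr_ge0 //.
      by rewrite mulrC.
    rewrite -mulr_sumr ler_wpM2l ?sum_geo2_le //.
    by apply: le_trans (aM (0, 0)%N); rewrite mulr_ge0 // exprn_ge0 // ltW.
  - move=> s e /andP[s0 s1] e0.
    have st0 : 0 <= s * t by rewrite mulr_ge0 // ltW.
    have std : s * t <= d.
      by apply: le_trans td; rewrite ler_piMl // ltW.
    have st1 : s * t <= 1 := le_trans std d1.
    have [||r [ur mr le_e]] := small ((s * t) ^+ k0.+1) (s * t) e (j0, k0) a0 _ _ e0.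
    + rewrite exprn_ge0 //=; apply: le_trans std.
      by rewrite exprS ler_piMr // exprn_ile1.
    + by rewrite st0.
    exists r; split=> //; congr (`|_| <= _): le_e; apply: eq_bigr => m _.
    by rewrite -exprM -exprD [(_ * m.1)%N]mulnC exprMn mulrA.
by move/eqP; rewrite mulf_eq0 (negPf a0) orbF expf_eq0 (gt_eqF t0) andbF.
Qed.


End PowerSeriesIdentity.

(** * From a convergent expansion to commutation of its coefficients *)

Section ExpansionCoefficients.
Variable K : numClosedFieldType.
Local Open Scope classical_set_scope.

(** An entry of a commutator is a finite combination of matrix entries, each a continuous function.
    The filter is arbitrary, to serve both the net of finite sets and sequences. *)
Lemma cvg_mulmx_comm n (M : 'M[K]_n) i j (X : Type) (F : set_system X)
    (u : X -> 'M[K]_n) (l : 'M[K]_n) : Filter F -> u @ F --> l ->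
  (fun x => (u x *m M - M *m u x) i j) @ F --> (l *m M - M *m l) i j.
Proof.
move=> FF ul.
have entry k k' : (fun x => u x k k') @ F --> l k k'.
  exact: (cvg_comp u (fun N : 'M[K]_n => N k k') ul
            (@coord_continuous K n n k k' l)).
rewrite !mxE; under eq_cvg do rewrite !mxE.
apply: cvgB; (apply: cvg_big => [p|k _]; first exact: add_continuous).
  by apply: cvgMr_tmp; exact: entry.
by apply: cvgMl_tmp; exact: entry.
Qed.

Lemma small_radius (e : K) : 0 < e -> {d : K | 0 < d <= 1 & d < e}.
Proof.
move=> e0; have e1 : 0 < 1 + e by rewrite addr_gt0.
exists (e / (1 + e)); first by rewrite divr_gt0 //= ler_pdivrMr // mul1r lerDr.
by rewrite ltr_pdivrMr // ltr_pMr // ltrDl.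
Qed.

Lemma expansion2_comm n (F : K -> K -> 'M[K]_n) x0 y0 T (M : 'M[K]_n) :
  (forall x y, comm_mx (F x y) M) -> expansion2 F x0 y0 T ->
  forall m, comm_mx (T m) M.
Proof.
move=> FM /nbhs_ballP[e /= e0 eF] q.
have [d d01 de] := small_radius e0; case/andP: (d01) => d0 d1.
apply/eqP; rewrite -subr_eq0; apply/eqP/matrixP => i j; rewrite [RHS]mxE.
pose phi (N : 'M[K]_n) := (N *m M - M *m N) i j.
(* [phi] is linear, so it maps the matrix expansion to a scalar one, whose sum is an entry of a
   vanishing commutator. *)
have phi_sum (c : nat * nat -> K) (A : {fset nat * nat}) :
    phi (summability.partial_sum (fun m => c m *: T m) A) =
    \sum_(m <- A) c m * phi (T m).
  rewrite big_seq_fsetE /phi /summability.partial_sum mulmx_suml mulmx_sumr.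
  rewrite -sumrB summxE; apply: eq_bigr => k _.
  by rewrite -scalemxAl -scalemxAr -scalerBr mxE.
have FT : Filter (@totally (nat * nat)%type) := totally_filter.
have cvg0 x y : 0 <= x <= d -> 0 <= y <= d ->
    (fun A : {fset nat * nat} => \sum_(m <- A) x ^+ m.1 * y ^+ m.2 * phi (T m))
      @ summability.totally --> (0 : K).
  move=> /andP[x_ge0 xd] /andP[y_ge0 yd].
  have : ball (x0, y0) e (x0 + x, y0 + y).
    by split; rewrite /= -ball_normE /= opprD addNKr normrN ger0_norm //;
      apply: le_lt_trans de.
  move=> /eF /= /(@cvg_mulmx_comm n M i j _ _ _ _ FT).
  rewrite FM subrr mxE [x0 + x]addrC [y0 + y]addrC !addrK.
  under eq_cvg => A do rewrite -/(phi _) phi_sum.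
  by apply.
suff : forall m, phi (T m) = 0 by exact.
have dd : 0 <= d <= d by rewrite lexx ltW.
have [N aN] : exists N, forall m, `|phi (T m)| * d ^+ (m.1 + m.2) <= N.
  have /cvgr0Pnorm_le /(_ _ ltr01) [A0 _ small] := cvg0 d d dd dd.
  pose f (m : nat * nat) := d ^+ m.1 * d ^+ m.2 * phi (T m).
  have fE m : `|phi (T m)| * d ^+ (m.1 + m.2) = `|f m|.
    by rewrite /f -exprD normrM [RHS]mulrC normrX (gtr0_norm d0).
  (* Sums over finite sets containing [A0] have modulus at most 1. A term outside [A0] is the
     difference of two of them, hence at most 2; a term in [A0] is bounded by the sum over [A0]. *)
  exists (2 + \sum_(m <- A0) `|f m|) => m; rewrite fE.
  have [mA0|mA0] := boolP (m \in A0).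
    rewrite (big_fsetD1 m) //= addrCA lerDl addr_ge0 // sumr_ge0 //.
  have -> : f m = \sum_(m <- (m |` A0)%fset) f m - \sum_(m <- A0) f m.
    by rewrite big_fsetU1 //= addrK.
  apply: le_trans (ler_normB _ _) _; apply: ler_wpDr; first exact: sumr_ge0.
  by apply: lerD; apply: small; rewrite /= ?fsubsetU1.
apply: (power_series2_eq0 d01 aN) => x y eps m0 _ xd yd eps0.
have /cvgr0Pnorm_le /(_ _ eps0) [A0 _ small] := cvg0 x y xd yd.
exists (m0 |` A0)%fset; split; first exact: fset_uniq.
  by rewrite fset1U1.
by apply: small; rewrite /= fsubsetU1.
Qed.

Lemma expansion_comm n (F : K -> 'M[K]_n) b0 T (M : 'M[K]_n) :
  (forall b, comm_mx (F b) M) -> expansion F b0 T -> forall k, comm_mx (T k) M.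
Proof.
move=> FM /nbhs_ballP[e /= e0 eF] q.
have [d d01 de] := small_radius e0; case/andP: (d01) => d0 d1.
apply/eqP; rewrite -subr_eq0; apply/eqP/matrixP => i j; rewrite [RHS]mxE.
pose phi (N : 'M[K]_n) := (N *m M - M *m N) i j.
have phi_sum (c : nat -> K) N :
    phi (series (fun m => c m *: T m) N) = series (fun m => c m * phi (T m)) N.
  rewrite /phi /series /= mulmx_suml mulmx_sumr -sumrB summxE.
  by apply: eq_bigr => m _; rewrite -scalemxAl -scalemxAr -scalerBr mxE.
have cvg0 y : 0 <= y <= d ->
    series (fun m => y ^+ m * phi (T m)) @ \oo --> (0 : K).
  move=> /andP[y_ge0 yd].
  have : ball b0 e (b0 + y).
    by rewrite -ball_normE /= opprD addNKr normrN ger0_norm // (le_lt_trans yd).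
  move=> /eF /= /(@cvg_mulmx_comm n M i j _ _ _ _ _).
  rewrite FM subrr mxE [b0 + y]addrC !addrK.
  under eq_cvg => N do rewrite -/(phi _) phi_sum.
  by apply.
(* The one-variable series is treated as a double series supported on the row [m.1 = 0]. *)
suff phi0 : forall m, (if m.1 == 0%N then phi (T m.2) else 0) = 0.
  exact: (phi0 (0, q)%N).
(* The terms of the series converging at [d] tend to 0, hence are bounded. *)
have [N aN] : exists N, forall m, `|d ^+ m * phi (T m)| <= N.
  have := cvg0 d; rewrite lexx ltW // => /(_ isT) cvgd.
  have /cvgP/cvg_seq_bounded : (fun m => d ^+ m * phi (T m)) @ \oo --> (0 : K).
    by apply: cvg_series_cvg_0; apply/cvg_ex; exists 0.
  by case=> N [_ bN]; exists (N + 1) => m;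
    apply: (bN (N + 1)) => //; rewrite ltrDl.
apply: (power_series2_eq0 (M := N) d01) => [[[|l] m]|x y eps [[|l] m]] /=.
- by rewrite add0n mulrC -[d](gtr0_norm d0) -normrX -normrM.
- by rewrite normr0 mul0r; apply: le_trans (aN 0).
- move=> _ xd yd eps0.
  have /cvgr0Pnorm_le /(_ _ eps0) [A _ small] := cvg0 y yd.
  (* An initial segment long enough both to reach the tail where partial sums are small and to
     contain the index [m]. *)
  exists [seq (0%N, p) | p <- index_iota 0 (maxn A m.+1)]; split.
  + by rewrite map_inj_uniq ?iota_uniq // => ? ? [].
  + by rewrite mem_map ?mem_index_iota ?leq_max ?leqnn ?orbT // => ? ? [].
  + rewrite big_map /=; under eq_bigr do rewrite mul1r.
    by apply: small; rewrite /= leq_maxl.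
- by rewrite eqxx.
Qed.



End ExpansionCoefficients.

(** * Commuting transfer matrices and expansion coefficients *)

Theorem proposition3 (R : realType)
    (A : CC R -> CC R -> op (CC R) 2)
    (B : CC R -> op (CC R) 2)
    (C : CC R -> CC R -> op (CC R) 2)
    (hABC : forall b x y : CC R,
       op_at (0 : 'I_3) (1 : 'I_3) (A x y) *m op_at (0 : 'I_3) (2 : 'I_3) (B b)
         *m op_at (1 : 'I_3) (2 : 'I_3) (C x y)
       = op_at (1 : 'I_3) (2 : 'I_3) (C x y) *m op_at (0 : 'I_3) (2 : 'I_3) (B b)
         *m op_at (0 : 'I_3) (1 : 'I_3) (A x y))
    (hA : forall x y : CC R, A x y \in unitmx)
    (L : nat) (hL : (1 <= L)%N) :
  (forall b x y : CC R, comm_mx (transfer L (B b)) (transfer L (C x y)))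
  /\
  (forall (x0 y0 : CC R) (T : nat * nat -> op (CC R) L),
     expansion2 (fun x y => transfer L (C x y)) x0 y0 T ->
     (forall (m : nat * nat) (b : CC R), comm_mx (T m) (transfer L (B b)))
     /\
     (B 0 = perm_op ->
      forall I : nat -> op (CC R) L,
        expansion (fun b => transfer L (B b)) 0 I ->
        forall (m : nat * nat) (k : nat), comm_mx (T m) (I k))).
Proof.
have comm b x y : comm_mx (transfer L (B b)) (transfer L (C x y)).
  exact: transfer_comm (hA x y) (hABC b x y).
split=> // x0 y0 T TC.
have commT m b : comm_mx (T m) (transfer L (B b)).
  by apply: (expansion2_comm _ TC) => x y; exact/comm_mx_sym.
split=> // _ I IB m k; apply/comm_mx_sym.
(* Now [T m] is the fixed matrix, and it is the transfer matrix of [B] that is expanded. *)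
by apply: (expansion_comm _ IB) => b; exact/comm_mx_sym.
Qed.
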